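(* Let $K\subset\mathbb{R}^n$ be a nonempty compact set such that $\partial\,\mathrm{conv}(K)\subseteq K$. Let $\mathcal{F}=\{Q_1,\dots,Q_s\}$ be a finite family of linear subspaces of $\mathbb{R}^n$ with $1\le \dim(Q_i)\le n-2$ for all $i$, and let $\{H_m\}_{m\in\mathbb{N}}$ be a sequence with $H_m\in\mathcal{F}$ for every $m$. Then the sequence \[K_m:=F_{H_m}\cdots F_{H_1}K\] converges in the Hausdorff metric to a compact convex set $L$, and $L$ is the Hausdorff limit of the sequence $F_{H_m}\cdots F_{H_1}\mathrm{conv}(K)$. Moreover, $L$ is symmetric with respect to every subspace $Q_j\in\mathcal{F}$ that appears infinitely often in $\{H_m\}$ (i.e. $R_{Q_j}L=L$).
   Context: For a linear subspace $H\subseteq\mathbb{R}^n$, $R_H$ is the reflection with respect to $H$: $R_H x=2(x|H)-x$, where $x|H$ is the orthogonal projection of $x$ onto $H$; $H^\perp$ is the orthogonal complement. Minkowski sum: $X+Y=\{x+y:x\in X,y\in Y\}$, $tX=\{tx:x\in X\}$. The fiber symmetrization of a compact set $C$ with respect to $H$ is \[F_H C:=\bigcup_{x\in H}\Big[\tfrac12\big(C\cap(H^\perp+x)\big)+\tfrac12\big(R_H C\cap(H^\perp+x)\big)\Big].\] $\mathrm{conv}$ denotes convex hull, $\partial$ the boundary; convergence is in the Hausdorff metric. *)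

(* Defs.v *)
From HB Require Import structures.
From mathcomp Require Import all_boot all_order all_algebra.
From mathcomp Require Import all_classical all_reals all_analysis.
Set Implicit Arguments. Unset Strict Implicit. Unset Printing Implicit Defensive.
Import Order.TTheory GRing.Theory Num.Theory.
Import numFieldNormedType.Exports.
Local Open Scope classical_set_scope.
Local Open Scope ring_scope.

Section Defs.
Variables (R : realType) (n : nat).
Local Notation V := 'rV[R]_n.

Definition dotv (u v : V) : R := \sum_(i < n) u 0 i * v 0 i.
Definition enorm (u : V) : R := Num.sqrt (dotv u u).

Definition oproj (H : {vspace V}) (x : V) : V :=
  xget 0 [set p | p \in H /\ forall h, h \in H -> dotv (x - p) h = 0].

Definition refl (H : {vspace V}) (x : V) : V := 2%:R *: oproj H x - x.

Definition perp_shift (H : {vspace V}) (x : V) : set V :=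
  [set y | forall h, h \in H -> dotv (y - x) h = 0].

Definition fiber_sym (H : {vspace V}) (C : set V) : set V :=
  [set z | exists x, x \in H /\
     exists a b, (C `&` perp_shift H x) a /\
                 ((refl H @` C) `&` perp_shift H x) b /\
                 z = 2^-1 *: a + 2^-1 *: b].

Fixpoint iter_sym (Hs : nat -> {vspace V}) (C : set V) (m : nat) : set V :=
  match m with
  | 0 => C
  | m'.+1 => fiber_sym (Hs m') (iter_sym Hs C m')
  end.

Definition convex (A : set V) : Prop :=
  forall x y (t : R), A x -> A y -> 0 <= t -> t <= 1 ->
    A (t *: x + (1 - t) *: y).

Definition chull (A : set V) : set V :=
  [set x | forall C, convex C -> A `<=` C -> C x].

Definition bdry (A : set V) : set V := closure A `\` (A°).

Definition enbhd (A : set V) (e : R) : set V :=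
  [set x | exists a, A a /\ enorm (x - a) <= e].

Definition hausdorff_cvg (A : nat -> set V) (L : set V) : Prop :=
  forall e : R, 0 < e -> exists N, forall m, (N <= m)%N ->
    A m `<=` enbhd L e /\ L `<=` enbhd (A m) e.

End Defs.

(* Main.v *)
(** Boundary: put C = conv K. If H has codimension at least 2 and a, c are two
    points of C on the same fiber of H, choose w <> 0 orthogonal to H and to
    z = a - c, and let p maximise <w, .> among the points with p and p - z in C
    on that fiber. Neither p nor p - z is interior to C, so both lie in K;
    since p - (p - z) = a - c, this shows F_H K = F_H C, and the two sequences
    agree from the first step on.

    Convex case: the support function of F_H C is at most (h_C + h_C o R_H) / 2.
    For a finite net U of the unit ball, the energy
      sup over linear isometries g of the sum over u in U of (h_C(g u) + M)^2
    therefore decreases along the sequence, with a quadratic gain that forces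
    h_m - h_m o R_{H_m} to tend to 0 uniformly. Let L be a cluster point.
    A subset of a small neighbourhood of L with at least the energy of L is
    Hausdorff close to L, and neighbourhoods of L are preserved by F_H whenever
    R_H L = L. If R_{H_m} L <> L for infinitely many m, then at the first such m
    following a time when K_m is close to L, the set K_m is still close to L, so
    L is almost symmetric with respect to H_m; as the family is finite this is
    impossible. Hence eventually R_{H_m} L = L, and K_m converges to L. *)
Require Import Defs.
From HB Require Import structures.
From mathcomp Require Import all_boot all_order all_algebra.
From mathcomp Require Import all_classical all_reals all_analysis.
From mathcomp Require Import ring lra.
Import Order.TTheory GRing.Theory Num.Theory.
Import numFieldNormedType.Exports.
Local Open Scope classical_set_scope.
Local Open Scope ring_scope.
Set Implicit Arguments.
Unset Strict Implicit.
Unset Printing Implicit Defensive.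

(** * Inner product, projections, reflections and the algebra of fiber symmetrization *)

Section Euclidean.
Variables (R : realType) (n : nat).
Local Notation V := 'rV[R]_n.
Implicit Types (u v w x y z : V) (H : {vspace V}) (A B C L : set V).

Lemma dotvC u v : dotv u v = dotv v u.
Proof. by apply: eq_bigr => i _; rewrite mulrC. Qed.

Lemma dotvDl u v w : dotv (u + v) w = dotv u w + dotv v w.
Proof. by rewrite -big_split; apply: eq_bigr => i _; rewrite mxE mulrDl. Qed.

Lemma dotvDr u v w : dotv u (v + w) = dotv u v + dotv u w.
Proof. by rewrite dotvC dotvDl !(dotvC u). Qed.

Lemma dotvZl a u v : dotv (a *: u) v = a * dotv u v.
Proof. by rewrite /dotv mulr_sumr; apply: eq_bigr => i _; rewrite mxE mulrA. Qed.

Lemma dotvZr a u v : dotv u (a *: v) = a * dotv u v.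
Proof. by rewrite dotvC dotvZl dotvC. Qed.

Lemma dotvNl u v : dotv (- u) v = - dotv u v.
Proof. by rewrite -scaleN1r dotvZl mulN1r. Qed.

Lemma dotvNr u v : dotv u (- v) = - dotv u v.
Proof. by rewrite dotvC dotvNl dotvC. Qed.

Lemma dotv0l v : dotv 0 v = 0.
Proof. by rewrite -(scale0r 0) dotvZl mul0r. Qed.

Lemma dotv0r v : dotv v 0 = 0.
Proof. by rewrite dotvC dotv0l. Qed.

Definition dotvE := (dotvDl, dotvDr, dotvNl, dotvNr, dotvZl, dotvZr).

Lemma dotv_ge0 u : 0 <= dotv u u.
Proof. by apply: sumr_ge0 => i _; rewrite -expr2 sqr_ge0. Qed.

Lemma dotv_eq0 u : dotv u u = 0 -> u = 0.
Proof.
move=> u0; apply/rowP => i; rewrite mxE; apply/eqP.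
rewrite -sqrf_eq0 expr2; apply/eqP.
have : (dotv u u == 0) by rewrite u0.
rewrite psumr_eq0 => [/allP/(_ i)|j _]; last by rewrite -expr2 sqr_ge0.
by rewrite mem_index_enum => /(_ isT) /eqP.
Qed.

Lemma enorm_ge0 u : 0 <= enorm u.
Proof. exact: sqrtr_ge0. Qed.

Lemma enorm_sqr u : enorm u ^+ 2 = dotv u u.
Proof. by rewrite sqr_sqrtr// dotv_ge0. Qed.

Lemma enorm_eq0 u : enorm u = 0 -> u = 0.
Proof. by move=> u0; apply: dotv_eq0; rewrite -enorm_sqr u0 expr0n. Qed.

Lemma enorm_dotv_le (c : R) u : 0 <= c -> (enorm u <= c) = (dotv u u <= c ^+ 2).
Proof. by move=> c0; rewrite -enorm_sqr ler_sqr ?nnegrE ?enorm_ge0. Qed.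

Lemma enormZ (a : R) u : enorm (a *: u) = `|a| * enorm u.
Proof.
apply/eqP; rewrite -(@eqrXn2 _ 2)// ?mulr_ge0 ?enorm_ge0//.
by rewrite exprMn !enorm_sqr !dotvE -normrX ger0_norm ?sqr_ge0// mulrA -expr2.
Qed.

Lemma enormN u : enorm (- u) = enorm u.
Proof. by rewrite -scaleN1r enormZ normrN1 mul1r. Qed.

Lemma enorm0 : enorm (0 : V) = 0.
Proof. by rewrite /enorm dotv0l sqrtr0. Qed.

Lemma enormB u v : enorm (u - v) = enorm (v - u).
Proof. by rewrite -enormN opprB. Qed.

Lemma cauchy_schwarz u v : dotv u v <= enorm u * enorm v.
Proof.
have := enorm_ge0 u; rewrite le_eqVlt => /predU1P[u0|u_gt0].
  by rewrite (enorm_eq0 (esym u0)) dotv0l enorm0 mul0r.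
have := enorm_ge0 v; rewrite le_eqVlt => /predU1P[v0|v_gt0].
  by rewrite (enorm_eq0 (esym v0)) dotv0r enorm0 mulr0.
have := dotv_ge0 (enorm v *: u - enorm u *: v).
rewrite !dotvE (dotvC v u) -!enorm_sqr.
have uv_gt0 := mulr_gt0 u_gt0 v_gt0.
set a := enorm u in u_gt0 uv_gt0 *; set b := enorm v in v_gt0 uv_gt0 *.
set d := dotv u v => h.
rewrite -subr_ge0 -(pmulr_rge0 _ uv_gt0).
lra.
Qed.

Lemma enormD u v : enorm (u + v) <= enorm u + enorm v.
Proof.
rewrite enorm_dotv_le ?addr_ge0 ?enorm_ge0// !dotvE (dotvC v u) -!enorm_sqr.
have := cauchy_schwarz u v; lra.
Qed.

Lemma enorm_triangle v u w : enorm (u - w) <= enorm (u - v) + enorm (v - w).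
Proof. by apply: le_trans (enormD _ _); rewrite addrA subrK. Qed.

(** Gram-Schmidt along the spanning list: for [q] the projection of [v] onto the span of [X], the
    projection of [x] gains its component along [v - q]. *)
Lemma oproj_span_exists (X : seq V) x :
  exists2 p, p \in <<X>>%VS & forall h, h \in <<X>>%VS -> dotv (x - p) h = 0.
Proof.
elim: X x => [|v X IH] x.
  by exists 0 => [|h]; rewrite ?mem0v// span_nil memv0 => /eqP ->; rewrite dotv0r.
have [p pX px] := IH x; have [q qX qv] := IH v.
have sX h : h \in <<v :: X>>%VS -> exists a k, k \in <<X>>%VS /\ h = a *: (v - q) + k.
  rewrite span_cons => /memv_addP[_ /vlineP[a ->] [k kX ->]].
  exists a, (a *: q + k); split; first by rewrite memvD// memvZ.
  by rewrite scalerBr addrA subrK.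
have X_sub h : h \in <<X>>%VS -> h \in <<v :: X>>%VS.
  by rewrite span_cons; apply/subvP/addvSr.
have vX : v \in <<v :: X>>%VS by rewrite memv_span ?mem_head.
pose c := dotv (x - p) (v - q) / dotv (v - q) (v - q).
exists (p + c *: (v - q)) => [|_ /sX[a [k [kX ->]]]].
  apply: memvD; first exact: X_sub.
  by apply/memvZ/memvB => //; apply: X_sub.
rewrite opprD addrA dotvDl !dotvDr (px k)// dotvNl dotvZl dotvZr.
rewrite dotvNl !dotvZl !dotvZr (qv k)// mulr0 oppr0 !addr0.
have [z0|nz] := eqVneq (dotv (v - q) (v - q)) 0.
  by rewrite (dotv_eq0 z0) !dotv0r !mulr0 subr0.
by rewrite /c mulrCA divfK// subrr.
Qed.

Lemma oprojP H x :
  oproj H x \in H /\ forall h, h \in H -> dotv (x - oproj H x) h = 0.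
Proof.
rewrite /oproj; case: xgetP => [p -> //|none].
have [p pH px] := oproj_span_exists (vbasis H) x.
rewrite (span_basis (vbasisP H)) in pH px.
by case: (none p).
Qed.

Lemma oproj_in H x : oproj H x \in H.
Proof. by have [] := oprojP H x. Qed.

Lemma oproj_orth H x h : h \in H -> dotv (x - oproj H x) h = 0.
Proof. by have [_] := oprojP H x; apply. Qed.

Lemma oproj_unique H x p :
  p \in H -> (forall h, h \in H -> dotv (x - p) h = 0) -> oproj H x = p.
Proof.
move=> pH px; apply/eqP; rewrite -subr_eq0; apply/eqP/dotv_eq0.
have dH : oproj H x - p \in H by rewrite memvB ?oproj_in.
have := px _ dH; have := oproj_orth x dH.
rewrite -[x - p](subrKA (oproj H x)) [X in _ -> X = 0 -> _]dotvDl => ->.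
by rewrite add0r.
Qed.

Lemma oproj_linear H (a b : R) x y :
  oproj H (a *: x + b *: y) = a *: oproj H x + b *: oproj H y.
Proof.
apply: oproj_unique => [|h hH]; first by rewrite memvD ?memvZ ?oproj_in.
rewrite opprD addrACA -!scalerBr dotvDl !dotvZl !oproj_orth//.
by rewrite !mulr0 addr0.
Qed.

Lemma oproj_id H x : x \in H -> oproj H x = x.
Proof. by move=> xH; apply: oproj_unique => // h _; rewrite subrr dotv0l. Qed.

Lemma refl_linear H (a b : R) x y :
  refl H (a *: x + b *: y) = a *: refl H x + b *: refl H y.
Proof.
rewrite /refl oproj_linear !scalerBr scalerDr opprD addrACA.
by rewrite !scalerA !(mulrC 2).
Qed.

Lemma reflB H x y : refl H (x - y) = refl H x - refl H y.
Proof. by have := refl_linear H 1 (-1) x y; rewrite !scale1r !scaleN1r. Qed.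

Lemma oproj_refl H x : oproj H (refl H x) = oproj H x.
Proof.
rewrite /refl -[X in _ - X]scale1r -scaleNr oproj_linear (oproj_id (oproj_in _ _)).
by rewrite -scalerDl [2]mulr2n addrK scale1r.
Qed.

Lemma reflK H : involutive (refl H).
Proof. by move=> x; rewrite {1}/refl oproj_refl opprB addrCA subrr addr0. Qed.

Lemma refl0 H : refl H 0 = 0.
Proof. by rewrite -[X in refl H X](subrr 0) reflB subrr. Qed.

(** With P the projection onto [H], both sides equal 2 <Px, Py> - <x, y>. *)
Lemma dotv_reflr H x y : dotv x (refl H y) = dotv (refl H x) y.
Proof.
have e1 := oproj_orth x (oproj_in H y); have e2 := oproj_orth y (oproj_in H x).
move: e1 e2; rewrite /refl !dotvE => e1 e2.
rewrite (dotvC (oproj H x) y); rewrite (dotvC (oproj H y)) in e2.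
lra.
Qed.

Lemma enorm_refl H x : enorm (refl H x) = enorm x.
Proof. by rewrite /enorm -dotv_reflr reflK. Qed.

Lemma perp_shiftP H x y : x \in H -> perp_shift H x y <-> oproj H y = x.
Proof.
move=> xH; split; first exact: oproj_unique.
by move=> <- h; apply: oproj_orth.
Qed.

(** The working form of the definition: since [refl H] preserves the fibers of [H], the base point
    disappears and both points are taken in [C]. *)
Lemma fiber_symP H C z :
  fiber_sym H C z <->
  exists a c, [/\ C a, C c, oproj H a = oproj H c & z = 2^-1 *: a + 2^-1 *: refl H c].
Proof.
split=> [[x [xH [a [_ [[Ca ax] [[[c Cc <-] cx] ->]]]]]]|[a [c [Ca Cc ac ->]]]].
  exists a, c; split=> //; move/(perp_shiftP _ xH): ax => ->.
  by move/(perp_shiftP _ xH): cx; rewrite oproj_refl.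
exists (oproj H a); split; first exact: oproj_in.
exists a, (refl H c); split; first by split=> //; apply/perp_shiftP; rewrite ?oproj_in.
split=> //; split; first by exists c.
by apply/perp_shiftP; rewrite ?oproj_in// oproj_refl.
Qed.

Lemma fiber_symS H A B : A `<=` B -> fiber_sym H A `<=` fiber_sym H B.
Proof.
by move=> AB z /fiber_symP[a [c [/AB Ba /AB Bc ac ->]]]; apply/fiber_symP; exists a, c.
Qed.

Lemma fiber_sym_neq0 H C : C !=set0 -> fiber_sym H C !=set0.
Proof.
by case=> a Ca; eexists; apply/fiber_symP; exists a, a; split.
Qed.

Lemma fiber_sym_convex H C : convex C -> convex (fiber_sym H C).
Proof.
move=> cC z1 z2 t /fiber_symP[a [c [Ca Cc ac ->]]] /fiber_symP[b [d [Cb Cd bd ->]]] t0 t1.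
apply/fiber_symP; exists (t *: a + (1 - t) *: b), (t *: c + (1 - t) *: d).
split; [exact: cC|exact: cC|by rewrite !oproj_linear ac bd|].
rewrite refl_linear; apply/rowP => i; rewrite !mxE; ring.
Qed.

Lemma convex_half C x y : convex C -> C x -> C y -> C (2^-1 *: x + 2^-1 *: y).
Proof.
move=> cC Cx Cy; have half : 1 - 2^-1 = 2^-1 :> R by lra.
by rewrite -[X in _ + X *: _]half; apply: cC => //; lra.
Qed.

Lemma fiber_sym_sub_symmetric H C :
  convex C -> (forall x, C x -> C (refl H x)) -> fiber_sym H C `<=` C.
Proof.
by move=> cC rC _ /fiber_symP[a [c [Ca Cc _ ->]]]; apply: convex_half (rC _ _).
Qed.

End Euclidean.

(** * Comparison with the sup norm, and compactness *)

Section EuclideanTopology.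
Variables (R : realType) (n : nat).
Local Notation V := 'rV[R]_n.
Implicit Types (u v w x y z : V) (H : {vspace V}) (A B C L : set V).

Definition ebounded (M : R) A := forall x, A x -> enorm x <= M.

Lemma coord_le_mx_norm u i : `|u 0 i| <= `|u|.
Proof.
rewrite [leRHS]mx_normrE.
exact: (le_bigmax _ (fun ij : 'I_1 * 'I_n => `|u ij.1 ij.2|) (0, i)).
Qed.

Lemma mx_norm_le_enorm u : `|u| <= enorm u.
Proof.
rewrite [leLHS]mx_normrE; apply: bigmax_le => [|[i j] _] /=; first exact: enorm_ge0.
rewrite (ord1 i) -(@ler_sqr _ `|_|) ?nnegrE ?enorm_ge0// enorm_sqr real_normK ?num_real//.
by rewrite /dotv (bigD1 j)//= -expr2 lerDl sumr_ge0// => k _; rewrite -expr2 sqr_ge0.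
Qed.

Lemma enorm_le_mx_norm u : enorm u <= n.+1%:R * `|u|.
Proof.
rewrite enorm_dotv_le ?mulr_ge0// exprMn.
apply: (@le_trans _ _ (\sum_(i < n) `|u| ^+ 2)).
  apply: ler_sum => i _; rewrite -expr2 -(@real_normK _ (u 0 i)) ?num_real//.
  by rewrite ler_sqr ?nnegrE// coord_le_mx_norm.
rewrite sumr_const card_ord -[leLHS]mulr_natl.
rewrite ler_wpM2r ?sqr_ge0//.
by rewrite -natrX ler_nat (leq_trans (leqnSn n))// leq_pmulr.
Qed.

Lemma nbhs_enorm_ball x (e : R) : 0 < e -> nbhs x [set y | enorm (y - x) < e].
Proof.
move=> e0; apply/nbhs_ballP; exists (e / n.+1%:R) => /=; first by rewrite divr_gt0.
move=> y; rewrite mx_norm_ball /ball_ /= => xy.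
by rewrite enormB (le_lt_trans (enorm_le_mx_norm _))// mulrC -ltr_pdivlMr.
Qed.

Lemma enorm_lipschitz_continuous (f : V -> R) (k : R) :
  (forall x y, f x - f y <= k * enorm (x - y)) -> continuous f.
Proof.
move=> fk x; apply/(@cvgrPdist_lt _ _ _ (nbhs x) (nbhs_filter x)) => e e0.
have k0 : 0 < `|k| + 1 by rewrite ltr_wpDl.
have := @nbhs_enorm_ball x (e / (`|k| + 1)) (divr_gt0 e0 k0).
apply: filterS => y /= yx.
have h z z' : enorm (z - z') < e / (`|k| + 1) -> f z - f z' < e.
  rewrite ltr_pdivlMr// => h; apply: le_lt_trans h.
  rewrite (le_trans (fk _ _))// mulrC ler_wpM2l ?enorm_ge0//.
  by rewrite (le_trans (ler_norm k))// lerDl.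
by rewrite ltr_norml ltrNl opprB !h// enormB.
Qed.

Lemma dotv_continuous w : continuous (fun x : V => dotv x w).
Proof.
apply: (@enorm_lipschitz_continuous _ (enorm w)) => x y.
by rewrite -dotvNl -dotvDl mulrC; apply: cauchy_schwarz.
Qed.

Lemma enorm_dist_continuous w : continuous (fun x : V => enorm (x - w)).
Proof.
apply: (@enorm_lipschitz_continuous _ 1) => x y.
by rewrite mul1r lerBlDr; apply: enorm_triangle.
Qed.

Lemma interior_direction A x v :
  interior A x -> exists t : R, [/\ 0 < t, t <= 1 & A (x + t *: v)].
Proof.
move=> /nbhs_ballP[e /= e0 eA].
(* The bound 1 lets [t] serve as a convex weight; the added 1 covers [v = 0]. *)
pose t := Num.min 1 (e / (`|v| + 1)).
have v0 : 0 < `|v| + 1 by rewrite ltr_wpDl.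
exists t; split; rewrite ?/t; first by rewrite lt_min ltr01 divr_gt0.
  by rewrite ge_min lexx.
apply: eA; rewrite mx_norm_ball /ball_ /= opprD addNKr normrN normrZ.
rewrite ger0_norm ?le_min ?ler01 ?ltW ?divr_gt0//.
apply: (@le_lt_trans _ _ (e / (`|v| + 1) * `|v|)).
  by rewrite ler_wpM2r// ge_min lexx orbT.
by rewrite mulrAC -mulrA gtr_pMr// ltr_pdivrMr// mul1r ltrDl.
Qed.

Lemma closed_ebounded_compact (M : R) A : closed A -> ebounded M A -> compact A.
Proof.
move=> cA bA; apply: bounded_closed_compact cA.
rewrite /bounded_set /=; exists M; split; first exact: num_real.
move=> N MN x /bA xM; apply: le_trans (mx_norm_le_enorm _) _.
exact: le_trans xM (ltW MN).
Qed.

Lemma compact_ebounded A : compact A -> exists M : R, ebounded M A.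
Proof.
move=> /compact_bounded[M [_ bM]]; exists (n.+1%:R * (M + 1)) => x Ax.
apply: le_trans (enorm_le_mx_norm _) _; rewrite ler_wpM2l//.
by apply: bM Ax; rewrite ltrDl.
Qed.

Lemma eball_compact (M : R) : compact [set u : V | enorm u <= M].
Proof.
apply: (@closed_ebounded_compact M) => [|u //].
have -> : [set u : V | enorm u <= M] =
    (fun u : V => enorm (u - 0)) @^-1` [set t : R | t <= M].
  by apply/seteqP; split => u /=; rewrite subr0.
by apply: preimage_closed; [move=> u _; exact: enorm_dist_continuous|exact: closed_le].
Qed.

Lemma compact_finite_net A (d : R) : compact A -> 0 < d ->
  exists U : seq V, (forall u, u \in U -> A u) /\
    forall v, A v -> exists2 u, u \in U & enorm (v - u) <= d.
Proof.
move=> cA d0.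
pose f u := [set v : V | enorm (v - u) < d].
have oP i : A i -> open (f i).
  move=> _; have -> : f i = (fun v : V => enorm (v - i)) @^-1` [set t : R | t < d] by [].
  by apply: open_comp; [move=> v _; exact: enorm_dist_continuous|exact: open_lt].
have cP : A `<=` cover A f.
  by move=> v Av; exists v => //; rewrite /f /= subrr enorm0.
move: cA; rewrite compact_cover => /(_ _ A f oP cP)[D DA AD].
exists (finmap.enum_fset D); split => [u uD|v /AD[u uD uv]].
  by have := DA u uD; rewrite inE.
by exists u => //; apply: ltW.
Qed.

Lemma refl_continuous H : continuous (refl H : V -> V).
Proof.
move=> x; apply/(@cvgrPdist_lt _ _ _ (nbhs x) (nbhs_filter x)) => e e0.
have := @nbhs_enorm_ball x e e0; apply: filterS => y /= yx.
rewrite (le_lt_trans (mx_norm_le_enorm _))//.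
by rewrite -reflB enorm_refl enormB.
Qed.

(** A continuous image of the compact set of pairs in [C] whose difference is orthogonal to [H]. *)
Lemma fiber_sym_compact H C : compact C -> compact (fiber_sym H C).
Proof.
move=> cC.
pose D := [set p : V * V | forall h, h \in H -> dotv (p.1 - p.2) h = 0].
pose f (p : V * V) := 2^-1 *: p.1 + 2^-1 *: refl H p.2.
have -> : fiber_sym H C = f @` ((C `*` C) `&` D).
  apply/seteqP; split => [z /fiber_symP[a [c [Ca Cc ac ->]]]|_ [[a c] [[/= Ca Cc] ac] <-]].
    exists (a, c) => //; split => // h hH /=.
    have := oproj_orth a hH; have := oproj_orth c hH; rewrite ac !dotvE => h1 h2; lra.
  apply/fiber_symP; exists a, c; split => //.
  apply: oproj_unique => [|h hH]; first exact: oproj_in.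
  have := oproj_orth c hH; have := ac h hH; rewrite /= !dotvE => h1 h2; lra.
apply: continuous_compact.
  apply: continuous_subspaceT => p.
  apply: cvgD; apply: cvgZl_tmp; first exact: cvg_fst.
  by apply: cvg_comp; [exact: cvg_snd|exact: refl_continuous].
apply: compact_closedI; first exact: compact_setX.
have -> : D = \bigcap_(h in [set h | h \in H]) (fun p : V * V => dotv (p.1 - p.2) h) @^-1` [set 0].
  by apply/seteqP; split => p pD h hH; apply: pD.
apply: closed_bigI => h _; apply: preimage_closed; last exact: closed_eq.
move=> p _ /=; apply: (@continuous_comp _ _ _ (fun p : V * V => p.1 - p.2) (fun x => dotv x h)).
  by apply: cvgB; [exact: cvg_fst|exact: cvg_snd].
exact: dotv_continuous.
Qed.

End EuclideanTopology.

(** * Codimension two: one symmetrization does not distinguish K from its convex hull *)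

Section BoundaryFibers.
Variables (R : realType) (n : nat).
Local Notation V := 'rV[R]_n.
Implicit Types (u v w x y z : V) (H : {vspace V}) (A B C K L : set V).

Lemma chull_convex A : convex (chull A).
Proof.
by move=> x y t Ax Ay t0 t1 C cC AC; apply: (cC) => //; [exact: Ax|exact: Ay].
Qed.

Lemma sub_chull A : A `<=` chull A.
Proof. by move=> x Ax C _; apply. Qed.

Lemma eball_convex (M : R) : convex [set x : V | enorm x <= M].
Proof.
move=> x y t /= xM yM t0 t1; apply: le_trans (enormD _ _) _.
rewrite !enormZ !ger0_norm ?subr_ge0//.
have -> : M = t * M + (1 - t) * M by ring.
by rewrite lerD// ler_wpM2l// subr_ge0.
Qed.

Lemma chull_ebounded (M : R) A : ebounded M A -> ebounded M (chull A).
Proof. by move=> bA x /(_ [set y | enorm y <= M]); apply; [exact: eball_convex|exact: bA]. Qed.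

(** Closedness comes from the boundary hypothesis: a point of the closure is either interior or in
    [K]. *)
Lemma chull_compact K : compact K -> bdry (chull K) `<=` K -> compact (chull K).
Proof.
move=> /compact_ebounded[M bK] bdK.
apply: closed_ebounded_compact (chull_ebounded bK) => x clx.
have [|nint] := pselect ((chull K)° x); first exact: interior_subset.
by apply: sub_chull; apply: bdK.
Qed.

(** [H] and [z] span a proper subspace; subtract from an outside vector its projection there. *)
Lemma orthogonal_exists H z : (\dim H <= n - 2)%N -> (2 <= n)%N ->
  exists w, [/\ w != 0, forall h, h \in H -> dotv w h = 0 & dotv w z = 0].
Proof.
move=> dH n2; pose G := (H + <[z]>)%VS.
have dG : (\dim G < \dim {:V})%N.
  rewrite (leq_ltn_trans (dimv_add_leqif _ _))// dim_vline dimvf /dim /= mul1n.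
  apply: (@leq_ltn_trans (n - 2 + 1)); first by rewrite leq_add// leq_b1.
  by rewrite addn1 subn2; case: (n) n2 => [|[]].
have [x xG] : exists x, x \notin G.
  apply: contrapT => none; move: dG; rewrite ltnNge dimvS//.
  by apply/subvP => x _; apply: contrapT => /negP xG; apply: none; exists x.
exists (x - oproj G x); split.
- by rewrite subr_eq0; apply: contraNneq xG => ->; exact: oproj_in.
- by move=> h hH; apply: oproj_orth; apply: (subvP (addvSl _ _)).
- by apply: oproj_orth; apply: (subvP (addvSr _ _)); rewrite memv_line.
Qed.

(* Sliding the pair (p, p - z) slightly along z makes both points interior, so
   that both can then be pushed in the direction w. *)
Lemma push_parallel_pair C p z w : convex C -> C (p - z) -> C° p ->
  exists s t : R, 0 < t /\ C (p + s *: z + t *: w) /\ C (p + s *: z + t *: w - z).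
Proof.
move=> cC Cpz intp.
have [l [l0 l1 Cl]] := interior_direction w intp.
have [t [t0 t1 Ct]] := interior_direction (z + l *: w) intp.
exists t, (t * l); split; first exact: mulr_gt0.
split; first by move: Ct; rewrite scalerDr addrA scalerA.
(* The second point is t (p + l w) + (1 - t) (p - z). *)
have := cC _ _ _ Cl Cpz (ltW t0) t1; congr (C _).
apply/rowP => i; rewrite !mxE; ring.
Qed.

Lemma boundary_parallel_pair H C a c : convex C -> compact C ->
  (\dim H <= n - 2)%N -> (2 <= n)%N ->
  C a -> C c -> oproj H a = oproj H c ->
  exists p q, [/\ C p /\ ~ C° p, C q /\ ~ C° q,
    oproj H p = oproj H a, oproj H q = oproj H a & p - q = a - c].
Proof.
move=> cC kC dH n2 Ca Cc ac; set z := a - c.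
have zE : z = a - c by []; clearbody z.
have [w [w0 wH wz]] := orthogonal_exists z dH n2.
have zH : oproj H z = 0.
  by have := oproj_linear H 1 (-1) a c; rewrite !scale1r !scaleN1r ac subrr zE.
have wH0 : oproj H w = 0.
  by apply: oproj_unique => [|h hH]; rewrite ?mem0v// subr0 wH.
pose S := [set p | [/\ C p, C (p - z) & oproj H p = oproj H a]].
have kS : compact S.
  have -> : S = C `&` ((fun p => p - z) @^-1` C `&`
     \bigcap_(h in [set h | h \in H]) (fun p => dotv p h) @^-1` [set dotv (oproj H a) h]).
    apply/seteqP; split => [p [Cp Cpz pa]|p [Cp [Cpz pa]]].
      split=> //; split=> // h hH /=; rewrite -pa.
      by have := oproj_orth p hH; rewrite !dotvE => /subr0_eq.
    split=> //; apply: oproj_unique => [|h hH]; first exact: oproj_in.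
    by rewrite !dotvE (pa h hH) subrr.
  apply: compact_closedI => //; apply: closedI.
    apply: preimage_closed => [p _|].
      by apply: (@cvgB _ _ _ (nbhs p) _ id (cst z)); [|exact: cvg_cst].
    by apply: compact_closed kC; exact: norm_hausdorff.
  apply: closed_bigI => h _; apply: preimage_closed; last exact: closed_eq.
  by move=> p _; exact: dotv_continuous.
have Sa : S a by split=> //; rewrite zE opprB addrC subrK.
have [p /set_mem Sp maxp] : exists2 p, p \in S & forall q, q \in S -> dotv q w <= dotv p w.
  apply: compact_EVT_max => //; first by exists a.
  exact/continuous_subspaceT/dotv_continuous.
have [Cp Cpz pa] := Sp.
(* Moving by s z + t w stays in the fiber and raises <., w> by t |w|^2, against the maximality of
   [p]. *)
have nopush s t : 0 < t -> C (p + s *: z + t *: w) -> C (p + s *: z + t *: w - z) -> False.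
  move=> t0 C1 C2; have : S (p + s *: z + t *: w).
    split=> //; rewrite -[p + _]scale1r oproj_linear -[p]scale1r oproj_linear.
    by rewrite zH wH0 !scaler0 !addr0 !scale1r.
  move=> /mem_set/maxp; rewrite !dotvE (dotvC z w) wz mulr0 addr0 gerDl.
  rewrite pmulr_rle0// leNgt lt_neqAle dotv_ge0 andbT => /negP; apply.
  by rewrite eq_sym; apply: contra_neq w0; apply: dotv_eq0.
exists p, (p - z); split=> //.
- split=> // intp; have [s [t [t0 [C1 C2]]]] := push_parallel_pair w cC Cpz intp.
  exact: nopush t0 C1 C2.
- split=> // intq.
  (* Exchange the two points: [p - z] becomes the first point of a pair with difference [- z], hence
     [- s] below. *)
  have Cqz : C (p - z - - z) by rewrite opprK subrK.
  have [s [t [t0 [C1 C2]]]] := push_parallel_pair w cC Cqz intq.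
  apply: (nopush (- s) t t0); [move: C2|move: C1]; congr (C _);
    apply/rowP => i; rewrite !mxE; ring.
- have := oproj_linear H 1 (-1) p z; rewrite zH scaler0 addr0 scale1r.
  by rewrite !scale1r scaleN1r => ->.
- by rewrite opprB addrC subrK.
Qed.

Lemma fiber_sym_chull H K : compact K -> bdry (chull K) `<=` K ->
  (\dim H <= n - 2)%N -> (2 <= n)%N -> fiber_sym H K = fiber_sym H (chull K).
Proof.
move=> kK bdK dH n2; apply/seteqP; split; first by apply: fiber_symS; apply: sub_chull.
move=> _ /fiber_symP[a [c [Ca Cc ac ->]]].
have [p [q [[Cp np] [Cq nq] pa qa pq]]] :=
  boundary_parallel_pair (@chull_convex K) (chull_compact kK bdK) dH n2 Ca Cc ac.
have bd x : chull K x -> ~ (chull K)° x -> K x.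
  by move=> Cx nx; apply: bdK; split=> //; apply: subset_closure.
apply/fiber_symP; exists p, q; split; [exact: bd|exact: bd|by rewrite pa qa|].
(* On a fiber with projection x, a + R_H c = 2 x + (a - c) depends only on x and on the
   difference. *)
rewrite /refl qa -ac -!scalerDr; congr (_ *: _).
by rewrite addrCA -[in RHS]addrCA pq.
Qed.

End BoundaryFibers.

(** * Support functions and separation *)

Section SupportFunctions.
Variables (R : realType) (n : nat).
Local Notation V := 'rV[R]_n.
Implicit Types (u v w x y z : V) (H : {vspace V}) (A B C K L : set V) (M e : R).

(** A real [sup] is meaningful only for nonempty bounded sets, whence the recurring hypotheses
    [A !=set0] and [ebounded M A]. *)
Definition supp A u : R := sup [set dotv x u | x in A].

Lemma supp_le A u (c : R) :
  A !=set0 -> (forall x, A x -> dotv x u <= c) -> supp A u <= c.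
Proof.
by move=> [a Aa] Ac; apply: ge_sup; [exists (dotv a u), a|move=> _ [x Ax <-]; exact: Ac].
Qed.

Lemma le_supp M A u x : ebounded M A -> A x -> dotv x u <= supp A u.
Proof.
move=> bA Ax; apply: sup_upper_bound; last by exists x.
split; first by exists (dotv x u), x.
exists (M * enorm u) => _ [y Ay <-]; apply: le_trans (cauchy_schwarz _ _) _.
by rewrite ler_wpM2r ?enorm_ge0 ?bA.
Qed.

Lemma supp_lipschitz M A u v : A !=set0 -> ebounded M A ->
  supp A u <= supp A v + M * enorm (u - v).
Proof.
move=> A0 bA; apply: supp_le => // x Ax.
rewrite -[u in dotv x u](subrK v) addrC dotvDr lerD ?(le_supp v bA)//.
by apply: le_trans (cauchy_schwarz _ _) _; rewrite ler_wpM2r ?enorm_ge0 ?bA.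
Qed.

Lemma supp_lipschitz_norm M A u v : A !=set0 -> ebounded M A ->
  `|supp A u - supp A v| <= M * enorm (u - v).
Proof.
move=> A0 bA; have := supp_lipschitz u v A0 bA; have := supp_lipschitz v u A0 bA.
by rewrite (enormB v u) ler_norml => h1 h2; apply/andP; split; lra.
Qed.

Lemma supp_norm_le M A u : A !=set0 -> ebounded M A -> enorm u <= 1 ->
  - M <= supp A u <= M.
Proof.
move=> A0 bA u1; have [a Aa] := A0.
have h x w : A x -> enorm w <= 1 -> dotv x w <= M.
  move=> Ax w1; apply: le_trans (cauchy_schwarz _ _) _.
  by rewrite -(mulr1 M) ler_pM ?enorm_ge0 ?bA.
apply/andP; split; last by apply: supp_le => // x Ax; apply: h.
apply: le_trans (le_supp u bA Aa).
by have := h a (- u) Aa; rewrite enormN => /(_ u1); rewrite dotvNr lerNl.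
Qed.

Lemma supp_enbhd M A B e u : A !=set0 -> ebounded M B ->
  A `<=` enbhd B e -> enorm u <= 1 -> supp A u <= supp B u + e.
Proof.
move=> A0 bB AB u1; apply: supp_le => // x /AB[b [Bb xb]].
rewrite -(subrK b x) addrC dotvDl lerD ?(le_supp u bB)//.
apply: le_trans (cauchy_schwarz _ _) (le_trans _ xb).
by rewrite ler_piMr ?enorm_ge0.
Qed.

Lemma supp_fiber_sym M H A u : A !=set0 -> ebounded M A ->
  supp (fiber_sym H A) u <= (supp A u + supp A (refl H u)) / 2.
Proof.
move=> A0 bA; apply: supp_le; first exact: fiber_sym_neq0.
move=> _ /fiber_symP[a [c [Aa Ac _ ->]]]; rewrite dotvDl !dotvZl -dotv_reflr.
have := le_supp u bA Aa; have := le_supp (refl H u) bA Ac => h1 h2; lra.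
Qed.

Lemma dotv_sqrD u v : dotv (u + v) (u + v) = dotv u u + 2 * dotv u v + dotv v v.
Proof. by rewrite !dotvE (dotvC v u); ring. Qed.

(** If some [z] made an acute angle at the nearest point [x], a short move from [x] towards [z]
    would come closer to [y]. *)
Lemma nearest_point_obtuse L y : L !=set0 -> compact L -> convex L ->
  exists2 x, L x & forall z, L z -> dotv (z - x) (y - x) <= 0.
Proof.
move=> L0 kL cL.
have [x /set_mem Lx minx] :
    exists2 x, x \in L & forall z, z \in L -> enorm (x - y) <= enorm (z - y).
  apply: (@compact_EVT_min _ _ (fun x => enorm (x - y))) => //; apply: continuous_subspaceT.
  exact: enorm_dist_continuous.
exists x => // z Lz; rewrite leNgt; apply/negP => d0.
set d := dotv (z - x) (y - x) in d0; set q := dotv (z - x) (z - x).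
have q0 : 0 <= q by exact: dotv_ge0.
(* This gives t q < 2 d, so the change t^2 q - 2 t d of the squared distance is negative. *)
pose t := Num.min 1 (d / (q + 1)).
have t0 : 0 < t by rewrite lt_min ltr01 divr_gt0// ltr_wpDl.
have t1 : t <= 1 by rewrite ge_min lexx.
have tq : t * (q + 1) <= d.
  by rewrite -ler_pdivlMr ?ge_min ?lexx ?orbT// ltr_wpDl.
have := minx _ (mem_set (cL _ _ _ Lz Lx (ltW t0) t1)).
rewrite enorm_dotv_le ?enorm_ge0// enorm_sqr.
have -> : t *: z + (1 - t) *: x - y = (x - y) + t *: (z - x).
  by apply/rowP => i; rewrite !mxE; ring.
have xyd : dotv (x - y) (z - x) = - d by rewrite -(opprB y x) dotvNl dotvC.
rewrite [leRHS]dotv_sqrD !dotvZr dotvZl -/q xyd => h.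
have : 0 <= t * (t * q - 2 * d) by lra.
rewrite pmulr_rge0//; lra.
Qed.

(** Test the hypothesis on the unit vector from the nearest point [x] to [y]: there the support
    function of [L] is attained at [x]. If [y = x], test on 0. *)
Lemma supp_separation M L y e : L !=set0 -> compact L -> convex L -> ebounded M L ->
  (forall v, enorm v <= 1 -> dotv y v <= supp L v + e) -> enbhd L e y.
Proof.
move=> L0 kL cL bL yL; have [x Lx xP] := nearest_point_obtuse y L0 kL cL.
exists x; split=> //; set w := y - x.
have := enorm_ge0 w; rewrite le_eqVlt => /predU1P[w0|w0].
  rewrite -w0; have := yL 0; rewrite enorm0 dotv0r => /(_ ler01).
  suff -> : supp L 0 = 0 by rewrite add0r.
  apply/eqP; rewrite eq_le; apply/andP; split.
    by apply: supp_le => // z _; rewrite dotv0r.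
  by rewrite -(dotv0r x); exact: (le_supp 0 bL Lx).
have w1 : enorm ((enorm w)^-1 *: w) <= 1.
  by rewrite enormZ ger0_norm ?invr_ge0 ?enorm_ge0// mulVf// gt_eqF.
have := yL _ w1; have : supp L ((enorm w)^-1 *: w) <= (enorm w)^-1 * dotv x w.
  apply: supp_le => // z Lz; rewrite dotvZr ler_pM2l ?invr_gt0//.
  by rewrite -subr_le0 -dotvNl -dotvDl xP.
rewrite dotvZr => h1 h2.
have wE : dotv w w = dotv y w - dotv x w by rewrite -dotvNl -dotvDl.
have : (enorm w)^-1 * dotv w w <= e by rewrite wE mulrBr; lra.
by rewrite -enorm_sqr expr2 mulKf// gt_eqF.
Qed.

End SupportFunctions.

(** * The energy, its decrease and its rigidity *)

Section Energy.
Variables (R : realType) (n : nat).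
Local Notation V := 'rV[R]_n.
Implicit Types (u v w x y z : V) (H : {vspace V}) (A B C K L : set V) (M e : R).
Implicit Types (U : seq V) (g : V -> V).

(** A distance preserving map fixing 0 is linear, so these are the orthogonal maps. *)
Definition linear_isometry g :=
  [/\ g 0 = 0, forall x y, enorm (g x - g y) = enorm (x - y) & forall y, exists x, g x = y].

Lemma linear_isometry_id : linear_isometry id.
Proof. by split=> // y; exists y. Qed.

Lemma linear_isometry_refl H g : linear_isometry g -> linear_isometry (refl H \o g).
Proof.
move=> [g0 gd gs]; split=> [|x y|y] /=; first by rewrite g0 refl0.
  by rewrite -reflB enorm_refl gd.
by have [x gx] := gs (refl H y); exists x; rewrite /= gx reflK.
Qed.

Lemma enorm_linear_isometry g u : linear_isometry g -> enorm (g u) = enorm u.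
Proof. by move=> [g0 gd _]; have := gd u 0; rewrite g0 !subr0. Qed.

(** For [A] in the ball of radius [M], the shift by [M] makes the squared quantities nonnegative, so
    that squaring is monotone. *)
Definition energy_at M U A g : R := \sum_(u <- U) (supp A (g u) + M) ^+ 2.

(* A supremum over all linear isometries instead of a rotation invariant integral. *)
Definition energy M U A : R := sup [set energy_at M U A g | g in linear_isometry].

Definition unit_seq U := forall u, u \in U -> enorm u <= 1.

Lemma unit_isometry U g u : unit_seq U -> linear_isometry g -> u \in U -> enorm (g u) <= 1.
Proof. by move=> U1 ig uU; rewrite enorm_linear_isometry// U1. Qed.

Lemma ler_sum_mem (f h : V -> R) U :
  (forall u, u \in U -> f u <= h u) -> \sum_(u <- U) f u <= \sum_(u <- U) h u.
Proof. by move=> fh; rewrite big_seq [leRHS]big_seq; apply: ler_sum. Qed.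

Lemma ler_term_sum (f : V -> R) U u :
  (forall v, v \in U -> 0 <= f v) -> u \in U -> f u <= \sum_(v <- U) f v.
Proof.
move=> f0 uU; rewrite (big_rem u)//= lerDl big_seq sumr_ge0// => v vU.
exact/f0/(mem_rem vU).
Qed.

Lemma sumr_const_size (c : R) U : \sum_(u <- U) c = c * (size U)%:R.
Proof. by rewrite big_const_seq count_predT iter_addr_0 mulr_natr. Qed.

Section Bounds.
Variables (M : R) (U : seq V).
Hypothesis U1 : unit_seq U.

Lemma energy_at_bound A g : A !=set0 -> ebounded M A -> linear_isometry g ->
  energy_at M U A g <= (2 * M) ^+ 2 * (size U)%:R.
Proof.
move=> A0 bA ig; rewrite -sumr_const_size; apply: ler_sum_mem => u uU.
have /andP[h1 h2] := supp_norm_le A0 bA (unit_isometry U1 ig uU).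
by rewrite ler_sqr ?nnegrE; lra.
Qed.

Lemma energy_has_sup A : A !=set0 -> ebounded M A ->
  has_sup [set energy_at M U A g | g in linear_isometry].
Proof.
move=> A0 bA; split; first by exists (energy_at M U A id), id => //; exact: linear_isometry_id.
by exists ((2 * M) ^+ 2 * (size U)%:R) => _ [g ig <-]; exact: energy_at_bound.
Qed.

Lemma energy_at_le A g : A !=set0 -> ebounded M A -> linear_isometry g ->
  energy_at M U A g <= energy M U A.
Proof. by move=> A0 bA ig; apply: sup_upper_bound; [exact: energy_has_sup|exists g]. Qed.

Lemma energy_le A (c : R) : A !=set0 -> ebounded M A ->
  (forall g, linear_isometry g -> energy_at M U A g <= c) -> energy M U A <= c.
Proof.
move=> A0 bA Ac; apply: ge_sup; last by move=> _ [g ig <-]; exact: Ac.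
by have [] := energy_has_sup A0 bA.
Qed.

Lemma energy_adherent A e : A !=set0 -> ebounded M A -> 0 < e ->
  exists2 g, linear_isometry g & energy M U A - e < energy_at M U A g.
Proof. by move=> A0 bA e0; have [_ [g ig <-]] := sup_adherent e0 (energy_has_sup A0 bA); exists g. Qed.

Lemma energy_ge0 A : A !=set0 -> ebounded M A -> 0 <= energy M U A.
Proof.
move=> A0 bA; apply: le_trans (energy_at_le A0 bA linear_isometry_id).
by apply: sumr_ge0 => u _; exact: sqr_ge0.
Qed.

(** Termwise a^2 - b^2 = (a - b)(a + b), with a - b at most [e] and a, b in [0, 2M]. *)
Lemma energy_enbhd A B e : A !=set0 -> ebounded M A -> B !=set0 -> ebounded M B ->
  0 <= e -> A `<=` enbhd B e ->
  energy M U A <= energy M U B + 4 * M * e * (size U)%:R.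
Proof.
move=> A0 bA B0 bB e0 AB; apply: energy_le => // g ig.
apply: le_trans (_ : energy_at M U B g + 4 * M * e * (size U)%:R <= _); last first.
  by rewrite lerD2r energy_at_le.
rewrite -sumr_const_size -big_split; apply: ler_sum_mem => u uU /=.
have gu1 := unit_isometry U1 ig uU.
have /andP[a1 a2] := supp_norm_le A0 bA gu1.
have /andP[b1 b2] := supp_norm_le B0 bB gu1.
have ab := supp_enbhd A0 bB AB gu1.
rewrite -lerBlDl subr_sqr.
nra.
Qed.

(** The square of a mean is the mean of the squares minus (a - b)^2 / 4. The reflected values belong
    to the isometry [refl H \o g], so both halves are bounded by the same supremum. *)
Lemma energy_at_fiber_sym H A g : A !=set0 -> ebounded M A -> ebounded M (fiber_sym H A) ->
  linear_isometry g ->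
  energy_at M U (fiber_sym H A) g +
    4^-1 * \sum_(u <- U) (supp A (g u) - supp A (refl H (g u))) ^+ 2 <= energy M U A.
Proof.
move=> A0 bA bF ig.
apply: le_trans (_ : 2^-1 * energy_at M U A g + 2^-1 * energy_at M U A (refl H \o g) <= _);
  last first.
  have := energy_at_le A0 bA ig; have := energy_at_le A0 bA (linear_isometry_refl H ig).
  by move=> h1 h2; lra.
rewrite /energy_at !mulr_sumr -!big_split /=; apply: ler_sum_mem => u uU.
have gu1 := unit_isometry U1 ig uU.
have /andP[a1 a2] := supp_norm_le A0 bA gu1.
have rgu1 : enorm (refl H (g u)) <= 1 by rewrite enorm_refl.
have /andP[b1 b2] := supp_norm_le A0 bA rgu1.
have /andP[c1 c2] := supp_norm_le (fiber_sym_neq0 H A0) bF gu1.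
have := supp_fiber_sym H (g u) A0 bA.
set a := supp A (g u) in a1 a2 *; set b := supp A _ in b1 b2 *.
set c := supp _ _ in c1 c2 * => cab.
have : (c + M) ^+ 2 <= ((a + b) / 2 + M) ^+ 2 by rewrite ler_sqr ?nnegrE; lra.
lra.
Qed.

Lemma energy_fiber_sym H A : A !=set0 -> ebounded M A -> ebounded M (fiber_sym H A) ->
  energy M U (fiber_sym H A) <= energy M U A.
Proof.
move=> A0 bA bF; apply: energy_le => [||g ig] //; first exact: fiber_sym_neq0.
apply: le_trans (energy_at_fiber_sym A0 bA bF ig).
by rewrite lerDl mulr_ge0 ?invr_ge0// sumr_ge0// => u _; exact: sqr_ge0.
Qed.

End Bounds.

(** An isometry carries a net of the unit ball to a net of the same mesh, so one list serves for all
    near-maximisers [g]. *)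
Lemma unit_net (d : R) : 0 < d ->
  exists2 U : seq V, unit_seq U & forall g, linear_isometry g ->
    forall v, enorm v <= 1 -> exists2 u, u \in U & enorm (v - g u) <= d.
Proof.
move=> d0; have [U [U1 Un]] := compact_finite_net (@eball_compact R n 1) d0.
exists U => // g ig v v1; have [_ gd gs] := ig; have [x gx] := gs v.
have [|u uU xu] := Un x; first by rewrite /= -(enorm_linear_isometry x ig) gx.
by exists u => //; rewrite -gx gd.
Qed.

Lemma ebounded_ge0 M A : A !=set0 -> ebounded M A -> 0 <= M.
Proof. by move=> [a Aa] bA; apply: le_trans (bA a Aa); exact: enorm_ge0. Qed.

(* On a maximiser g of the energy of A, the support functions of A and B cannot
   differ at any point of the net g(U). *)
Lemma supp_le_of_energy M e : 0 < e -> 0 <= M -> exists2 d : R, 0 < d &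
  forall A B, A !=set0 -> ebounded M A -> B !=set0 -> ebounded M B ->
    A `<=` enbhd B d -> (forall U, unit_seq U -> energy M U B <= energy M U A) ->
    forall v, enorm v <= 1 -> supp B v <= supp A v + e.
Proof.
move=> e0 M0.
have M1 : 0 < 4 * (M + 1) by lra.
have [U U1 Un] := unit_net (divr_gt0 e0 M1).
have k0 : 0 < 32 * (M + 1) * (size U).+1%:R by rewrite mulr_gt0//; lra.
(* Chosen so that the total slack 4 M d |U| is at most e^2 / 8; the added ones keep the denominator
   positive. *)
exists (e ^+ 2 / (32 * (M + 1) * (size U).+1%:R)); first by rewrite divr_gt0// exprn_gt0.
set d := _ / _ => A B A0 bA B0 bB AB EBA v v1.
have d0 : 0 <= d by rewrite divr_ge0 ?sqr_ge0// ltW.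
have dk : 4 * M * d * (size U)%:R <= e ^+ 2 / 8.
  have -> : e ^+ 2 / 8 = 4 * (M + 1) * d * (size U).+1%:R.
    rewrite /d; field; rewrite ?nmulrn ?pnatr_eq0.
    by apply/andP; split=> //; lra.
  apply: ler_pM; rewrite ?ler_nat//; first by apply: mulr_ge0 => //; apply: mulr_ge0.
  by rewrite ler_wpM2r//; lra.
have e8 : 0 < e ^+ 2 / 8 by rewrite divr_gt0// exprn_gt0.
have [g ig Eg] := energy_adherent U1 A0 bA e8.
have [u uU vu] := Un g ig v v1.
have gu1 := unit_isometry U1 ig uU.
have lB := supp_lipschitz v (g u) B0 bB.
have lA := supp_lipschitz (g u) v A0 bA; rewrite (enormB _ v) in lA.
have Mvu : M * enorm (v - g u) <= e / 4.
  apply: le_trans (_ : (M + 1) * (e / (4 * (M + 1))) <= _).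
    by rewrite ler_pM ?enorm_ge0//; lra.
  by rewrite le_eqVlt; apply/orP; left; apply/eqP; field; lra.
(* Replacing [v] by [g u] costs e / 4 for each of [A] and [B]. *)
suff : supp B (g u) <= supp A (g u) + e / 2 by lra.
(* The padding 4 M d makes every term nonnegative, so a single term is bounded by the whole sum. *)
pose f w := (supp B (g w) + M) ^+ 2 - (supp A (g w) + M) ^+ 2 + 4 * M * d.
have f0 w : w \in U -> 0 <= f w.
  move=> wU; have gw1 := unit_isometry U1 ig wU.
  have /andP[a1 a2] := supp_norm_le A0 bA gw1.
  have /andP[b1 b2] := supp_norm_le B0 bB gw1.
  have ab := supp_enbhd A0 bB AB gw1.
  rewrite /f subr_sqr; nra.
have : f u <= e ^+ 2 / 8 + e ^+ 2 / 8.
  apply: le_trans (ler_term_sum f0 uU) _.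
  rewrite /f big_split sumrB sumr_const_size /=.
  have := energy_at_le U1 B0 bB ig; have := EBA U U1.
  rewrite /energy_at in Eg * => h1 h2; lra.
rewrite /f subr_sqr.
have /andP[a1 a2] := supp_norm_le A0 bA gu1.
have /andP[b1 b2] := supp_norm_le B0 bB gu1.
have Md : 0 <= 4 * M * d by apply: mulr_ge0 => //; apply: mulr_ge0.
(* A gap above e / 2 would make the difference of squares exceed (e / 2)^2. *)
move=> h; rewrite leNgt; apply/negP => h2.
nra.
Qed.

End Energy.

(** * Blaschke selection by ultralimits *)

Section HausdorffCluster.
Variables (R : realType) (n : nat).
Local Notation V := 'rV[R]_n.
Implicit Types (u v w x y z : V) (A B C L : set V) (M e : R).

Lemma enbhd_convex A e : convex A -> convex (enbhd A e).
Proof.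
move=> cA x y t [a [Aa xa]] [b [Ab yb]] t0 t1.
exists (t *: a + (1 - t) *: b); split; first exact: cA.
have -> : t *: x + (1 - t) *: y - (t *: a + (1 - t) *: b) =
    t *: (x - a) + (1 - t) *: (y - b) by apply/rowP => i; rewrite !mxE; ring.
exact: (@eball_convex _ _ e).
Qed.

Lemma enbhd_le A (d e : R) : d <= e -> enbhd A d `<=` enbhd A e.
Proof. by move=> de x [a [Aa xa]]; exists a; split=> //; exact: le_trans xa de. Qed.

Lemma enbhd_trans A x y (d e : R) : enbhd A d y -> enorm (x - y) <= e -> enbhd A (d + e) x.
Proof.
move=> [a [Aa ya]] xy; exists a; split=> //.
by apply: le_trans (enorm_triangle y _ _) _; rewrite addrC lerD.
Qed.

Section Ultralimit.
Variables (K : nat -> set V) (M : R) (F : set_system nat).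
Hypotheses (K0 : forall m, K m !=set0) (bK : forall m, ebounded M (K m)).
Context {UF : UltraFilter F}.

Let L : set V := [set x | forall e, 0 < e -> F [set m | enbhd (K m) e x]].

Let ultralimit_ebounded : ebounded M L.
Proof.
move=> x Lx; apply/ler_addgt0Pr => e e0.
have [m [a [Ka xa]]] := filter_ex (Lx e e0).
rewrite -(subrK a x) addrC; apply: le_trans (enormD _ _) _.
by rewrite lerD// (bK Ka).
Qed.

Let ultralimit_closed : closed L.
Proof.
move=> x clx e e0; have e2 : 0 < e / 2 by lra.
have [y [Ly /= yx]] := clx _ (nbhs_enorm_ball x e2).
apply: filterS (Ly _ e2) => m /= Ky.
by rewrite (splitr e); apply: enbhd_trans Ky _; rewrite enormB ltW.
Qed.

Let ultralimit_convex : (forall m, convex (K m)) -> convex L.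
Proof.
move=> cK x y t Lx Ly t0 t1 e e0; apply: filterS2 (Lx e e0) (Ly e e0) => m /= Kx Ky.
exact: enbhd_convex (cK m) _ _ _ Kx Ky t0 t1.
Qed.

(** Otherwise, for [F]-almost all [m], choose a point of [K m] far from [L]; by compactness these
    points converge along [F], and their limit lies in [L]. *)
Let ultralimit_upper e : 0 < e -> F [set m | K m `<=` enbhd L e].
Proof.
move=> e0; have [//|FC] := in_ultra_setVsetC [set m | K m `<=` enbhd L e] UF.
have [f fP] : {f : nat -> V & forall m, ~ (K m `<=` enbhd L e) -> K m (f m) /\ ~ enbhd L e (f m)}.
  apply: (@choice _ _ (fun m x => ~ (K m `<=` enbhd L e) -> K m x /\ ~ enbhd L e x)) => m.
  have [?|nK] := pselect (K m `<=` enbhd L e); first by exists 0.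
  have [x Kx] : exists x, ~ (K m x -> enbhd L e x) by apply/existsNP.
  by exists x => _; apply/not_implyP.
have GB : F [set m | enorm (f m) <= M].
  by apply: filterS FC => m /= /fP[Kf _]; exact: bK Kf.
have [p [_ clp]] := @eball_compact R n M (f @ F) _ GB.
(* Along an ultrafilter a cluster point is a limit. *)
have near d : 0 < d -> F [set m | enorm (f m - p) < d].
  move=> d0; have [//|FN] := in_ultra_setVsetC [set m | enorm (f m - p) < d] UF.
  have GN : (f @ F) [set x | ~ enorm (x - p) < d] by [].
  by have [x [/= nx xp]] := clp _ _ GN (nbhs_enorm_ball p d0).
have Lp : L p.
  move=> d d0; apply: filterS2 FC (near d d0) => m /= /fP[Kf _] fp.
  by exists (f m); split=> //; rewrite enormB ltW.
have [m [/= /fP[_ nL] fp]] := filter_ex (filterI FC (near e e0)).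
by case: nL; exists p; split=> //; exact: ltW.
Qed.

(** A finite net of [L] reduces the inclusion to finitely many members of [F]. *)
Let ultralimit_lower e : 0 < e -> F [set m | L `<=` enbhd (K m) e].
Proof.
move=> e0; have e2 : 0 < e / 2 by lra.
have kL := closed_ebounded_compact ultralimit_closed ultralimit_ebounded.
have [U [UL Un]] := compact_finite_net kL e2.
have FU : F [set m | forall u, u \in U -> enbhd (K m) (e / 2) u].
  have {Un} : forall u, u \in U -> F [set m | enbhd (K m) (e / 2) u] by move=> u /UL; exact.
  elim: U {UL} => [|u U IH] FU; first by apply: filterS filterT.
  apply: filterS2 (FU u (mem_head _ _)) (IH _) => [m /= Ku KU v|v vU].
    by rewrite inE => /predU1P[->|/KU].
  by apply: FU; rewrite inE vU orbT.
apply: filterS FU => m /= KU x /Un[u uU xu].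
by rewrite (splitr e); apply: enbhd_trans (KU u uU) xu.
Qed.

Lemma ultralimit_exists : exists L : set V,
  [/\ compact L, L !=set0, ebounded M L, (forall m, convex (K m)) -> convex L &
    forall e, 0 < e -> F [set m | K m `<=` enbhd L e /\ L `<=` enbhd (K m) e]].
Proof.
exists L; split=> //.
- exact: closed_ebounded_compact ultralimit_closed ultralimit_ebounded.
- have [m KL] := filter_ex (ultralimit_upper ltr01).
  by have [x /KL[a [La _]]] := K0 m; exists a.
- by move=> e e0; apply: filterI; [exact: ultralimit_upper|exact: ultralimit_lower].
Qed.

End Ultralimit.

Lemma blaschke_selection (K : nat -> set V) M :
  (forall m, K m !=set0) -> (forall m, ebounded M (K m)) -> (forall m, convex (K m)) ->
  exists L : set V, [/\ compact L, L !=set0, ebounded M L, convex L &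
    forall e (N : nat), 0 < e ->
      exists2 m, (N <= m)%N & K m `<=` enbhd L e /\ L `<=` enbhd (K m) e].
Proof.
(* As [F] refines the eventuality filter, each of its members meets every tail. *)
move=> K0 bK cK; have [F [UF ooF]] := ultraFilterLemma (eventually_filter).
have [L [kL L0 bL cL KL]] := ultralimit_exists K0 bK (UF := UF).
exists L; split=> //; first exact: cL.
move=> e N e0.
have FN : F [set m | (N <= m)%N] by apply: ooF; exists N.
by have [m [Nm Km]] := filter_ex (filterI FN (KL e e0)); exists m.
Qed.

End HausdorffCluster.

(** * Convergence of iterated symmetrizations of convex bodies *)

Section IteratedSymmetrization.
Variables (R : realType) (n : nat).
Local Notation V := 'rV[R]_n.
Implicit Types (u v w x y z : V) (H : {vspace V}) (A B C L : set V) (e : R).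

Definition symmetric_wrt H A := forall x, A x -> A (refl H x).

Lemma symmetric_wrt_image H A : symmetric_wrt H A -> refl H @` A = A.
Proof.
move=> sA; apply/seteqP; split=> [_ [x Ax <-]|x Ax]; first exact: sA.
by exists (refl H x); [exact: sA|exact: reflK].
Qed.

Lemma enbhd_symmetric H A e : symmetric_wrt H A -> symmetric_wrt H (enbhd A e).
Proof.
move=> sA x [a [Aa xa]]; exists (refl H a); split; first exact: sA.
by rewrite -reflB enorm_refl.
Qed.

(** Separation with tolerance 0, since <R_H x, v> = <x, R_H v>. *)
Lemma symmetric_wrt_supp (M : R) H L : L !=set0 -> compact L -> convex L -> ebounded M L ->
  (forall v, enorm v <= 1 -> supp L v = supp L (refl H v)) -> symmetric_wrt H L.
Proof.
move=> L0 kL cL bL Lr x Lx.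
have [|a [La xa]] := @supp_separation _ _ M L (refl H x) 0 L0 kL cL bL.
  by move=> v v1; rewrite addr0 -dotv_reflr Lr// (le_supp _ bL Lx).
suff /subr0_eq -> : refl H x - a = 0 by [].
by apply/enorm_eq0/eqP; rewrite eq_le xa enorm_ge0.
Qed.

Lemma fiber_sym_ebounded (M : R) H A : ebounded M A -> ebounded M (fiber_sym H A).
Proof.
move=> bA x /(fiber_symS bA); apply: (@fiber_sym_sub_symmetric _ _ H [set y | enorm y <= M]).
  exact: eball_convex.
by move=> y /=; rewrite enorm_refl.
Qed.

Lemma nonincreasing_small_decrement (a : nat -> R) e : 0 < e -> (forall m, 0 <= a m) ->
  (forall m, a m.+1 <= a m) -> exists N, forall m, (N <= m)%N -> a m - a m.+1 <= e.
Proof.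
move=> e0 a0 da.
have hi : has_inf (range a).
  by split; [exists (a 0), 0%N|exists 0 => _ [m _ <-]].
have [_ [N _ <-] aN] := inf_adherent e0 hi.
have mono m : (N <= m)%N -> a m <= a N.
  move=> /subnK <-; elim: (m - N)%N => [|k]; rewrite ?add0n// addSn.
  exact: le_trans.
exists N => m Nm; have := mono m Nm.
have : inf (range a) <= a m.+1 by apply: inf_lbound; [have [] := hi|exists m.+1].
by lra.
Qed.

Lemma finite_family_lbound (T : finType) (f : T -> R) :
  (forall i, 0 < f i) -> exists2 e, 0 < e & forall i, e <= f i.
Proof.
move=> f0; exists (\big[Num.min/1]_i f i); first by apply: lt_bigmin.
by move=> i; exact: bigmin_le.
Qed.

Section Sequence.
Variables (Hs : nat -> {vspace V}) (C : set V) (M : R).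
Hypotheses (C0 : C !=set0) (kC : compact C) (cC : convex C) (bC : ebounded M C).
Local Notation K := (iter_sym Hs C).

Lemma iter_sym_neq0 m : K m !=set0.
Proof. by elim: m => //= m; exact: fiber_sym_neq0. Qed.

Lemma iter_sym_compact m : compact (K m).
Proof. by elim: m => //= m; exact: fiber_sym_compact. Qed.

Lemma iter_sym_convex m : convex (K m).
Proof. by elim: m => //= m; exact: fiber_sym_convex. Qed.

Lemma iter_sym_ebounded m : ebounded M (K m).
Proof. by elim: m => //= m; exact: fiber_sym_ebounded. Qed.

Let K0 := iter_sym_neq0.
Let bK := iter_sym_ebounded.

Lemma energy_iter_sym U m k : unit_seq U -> (m <= k)%N ->
  energy M U (K k) <= energy M U (K m).
Proof.
move=> U1 /subnK <-; elim: (k - m)%N => [|j]; rewrite ?add0n// addSn /=.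
by apply: le_trans; exact: (energy_fiber_sym U1 (@K0 _) (@bK _) (@bK (j + m).+1)).
Qed.

(** Energy decrements become small, and at a near-maximiser [g] for the next set they control the
    squared asymmetries on the net g(U). *)
Lemma supp_asymptotically_symmetric e : 0 < e -> exists N, forall m, (N <= m)%N ->
  forall v, enorm v <= 1 -> `|supp (K m) v - supp (K m) (refl (Hs m) v)| <= e.
Proof.
move=> e0; have M0 := ebounded_ge0 C0 bC.
have M1 : 0 < 4 * (M + 1) by lra.
have [U U1 Un] := unit_net n (divr_gt0 e0 M1).
(* Spent twice, on the decrement and on the near-maximiser; the factor 4 then gives (e / 2)^2. The
   other e / 2 pays for replacing [v] by [g u]. *)
have e32 : 0 < e ^+ 2 / 32 by rewrite divr_gt0// exprn_gt0.
have [|m|N NP] := @nonincreasing_small_decrement (fun m => energy M U (K m)) _ e32.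
- by move=> m; exact: energy_ge0.
- exact: energy_iter_sym.
exists N => m /NP {}NP v v1; set H := Hs m.
have [g ig gE] := energy_adherent U1 (@K0 m.+1) (@bK m.+1) e32.
have [u uU vu] := Un g ig v v1.
have h := energy_at_fiber_sym U1 (@K0 m) (@bK m) (@bK m.+1) ig.
have : (supp (K m) (g u) - supp (K m) (refl H (g u))) ^+ 2 <= (e / 2) ^+ 2.
  apply: le_trans (@ler_term_sum _ _
    (fun w => (supp (K m) (g w) - supp (K m) (refl H (g w))) ^+ 2) _ _ _ uU) _.
    by move=> w _; exact: sqr_ge0.
  by rewrite /= in gE NP; rewrite -/H in h gE NP *; lra.
rewrite -ler_sqrt ?sqr_ge0// !sqrtr_sqr (@ger0_norm _ (e / 2)); last lra.
have l1 := supp_lipschitz_norm v (g u) (@K0 m) (@bK m).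
have l2 := supp_lipschitz_norm (refl H v) (refl H (g u)) (@K0 m) (@bK m).
rewrite -reflB enorm_refl in l2.
have Mvu : M * enorm (v - g u) <= e / 4.
  apply: le_trans (_ : (M + 1) * (e / (4 * (M + 1))) <= _).
    by rewrite ler_pM ?enorm_ge0//; lra.
  by rewrite le_eqVlt; apply/orP; left; apply/eqP; field; lra.
move: l1 l2; rewrite !ler_norml => /andP[? ?] /andP[? ?] /andP[? ?].
by apply/andP; split; lra.
Qed.

Section ClusterPoint.
Variable L : set V.
Hypotheses (L0 : L !=set0) (bL : ebounded M L) (kL : compact L) (cL : convex L).
Hypothesis KL : forall e (N : nat), 0 < e ->
  exists2 m, (N <= m)%N & K m `<=` enbhd L e /\ L `<=` enbhd (K m) e.

Lemma energy_cluster_le U m : unit_seq U -> energy M U L <= energy M U (K m).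
Proof.
move=> U1; apply/ler_addgt0Pr => e e0; have M0 := ebounded_ge0 C0 bC.
have k0 : 0 < 4 * (M + 1) * (size U).+1%:R by rewrite mulr_gt0//; lra.
have d0 := divr_gt0 e0 k0; set d := e / _ in d0.
have [k mk [_ LK]] := KL m d0.
apply: le_trans (energy_enbhd U1 L0 bL (@K0 k) (@bK k) (ltW d0) LK) _.
apply: lerD; first exact: energy_iter_sym.
have -> : e = 4 * (M + 1) * d * (size U).+1%:R.
  rewrite /d; field; rewrite ?nmulrn ?pnatr_eq0.
  by apply/andP; split=> //; lra.
have {}d0 := ltW d0.
apply: ler_pM; rewrite ?ler_nat//; first by apply: mulr_ge0 => //; apply: mulr_ge0.
by rewrite ler_wpM2r//; lra.
Qed.

(** Every [K m] has at least the energy of [L], so one-sided closeness becomes two-sided, with [d]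
    independent of [m]. *)
Lemma cluster_supp_le e : 0 < e -> exists2 d, 0 < d <= e &
  forall m, K m `<=` enbhd L d -> forall v, enorm v <= 1 -> supp L v <= supp (K m) v + e.
Proof.
move=> e0; have [d d0 dP] := @supp_le_of_energy _ n M e e0 (ebounded_ge0 C0 bC).
exists (Num.min d e); first by rewrite lt_min d0 e0 ge_min lexx orbT.
move=> m KmL; apply: dP => //; last by move=> U; exact: energy_cluster_le.
by apply: subset_trans KmL _; apply: enbhd_le; rewrite ge_min lexx.
Qed.

Lemma iter_sym_sub_enbhd m k e : (m <= k)%N ->
  (forall j, (m <= j < k)%N -> symmetric_wrt (Hs j) L) ->
  K m `<=` enbhd L e -> K k `<=` enbhd L e.
Proof.
move=> mk sL KmL; rewrite -(subnKC mk).
have : (m + (k - m) <= k)%N by rewrite subnKC.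
elim: (k - m)%N => [|i IH]; rewrite ?addn0// addnS /= => ik.
apply: subset_trans (fiber_symS (IH (ltnW ik))) _.
apply: fiber_sym_sub_symmetric; first exact: enbhd_convex.
by apply: enbhd_symmetric; apply: sL; rewrite leq_addr.
Qed.

Variables (s : nat) (Q : 'I_s -> {vspace V}).
Hypothesis HQ : forall m, exists i, Hs m = Q i.

Lemma cluster_eventually_symmetric :
  exists N, forall m, (N <= m)%N -> symmetric_wrt (Hs m) L.
Proof.
apply: contrapT => none.
have often N : exists m, (N <= m)%N && ~~ `[< symmetric_wrt (Hs m) L >].
  apply: contrapT => noN; apply: none; exists N => m Nm; apply: contrapT => nS.
  by apply: noN; exists m; rewrite Nm; apply/asboolPn.
(* [f i] measures how badly [Q i] fails to preserve [L]; finiteness of the family gives a common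
   lower bound [e]. *)
have [f fP] : {f : 'I_s -> R & forall i, 0 < f i /\ (~ symmetric_wrt (Q i) L ->
    exists2 v, enorm v <= 1 & f i < `|supp L v - supp L (refl (Q i) v)|)}.
  apply: (@choice _ _ (fun i e => 0 < e /\ (~ symmetric_wrt (Q i) L ->
    exists2 v, enorm v <= 1 & e < `|supp L v - supp L (refl (Q i) v)|))) => i.
  have [sQ|nQ] := pselect (symmetric_wrt (Q i) L); first by exists 1.
  have [v v1 nv] : exists2 v, enorm v <= 1 & supp L v <> supp L (refl (Q i) v).
    apply: contrapT => nov; apply: nQ; apply: symmetric_wrt_supp bL _ => // v v1.
    by apply: contrapT => nv; apply: nov; exists v.
  have d0 : 0 < `|supp L v - supp L (refl (Q i) v)|.
    by rewrite normr_gt0 subr_eq0; apply/eqP.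
  exists (`|supp L v - supp L (refl (Q i) v)| / 2); split; first by lra.
  by move=> _; exists v => //; lra.
have [e e0 ef] := finite_family_lbound (fun i => (fP i).1).
have e3 : 0 < e / 3 by lra.
have [N1 N1P] := supp_asymptotically_symmetric e3.
have [d /andP[d0 de] dP] := cluster_supp_le e3.
have [m Nm [KmL _]] := KL N1 d0.
(* [k] is the first bad time from [m] on, so all steps from [m] to [k] preserve the neighbourhood of
   [L]. *)
have [k /andP[mk /asboolPn nS] kmin] := ex_minnP (often m).
have KkL : K k `<=` enbhd L d.
  apply: iter_sym_sub_enbhd KmL => // j /andP[mj jk]; apply: contrapT => nj.
  have /kmin : (m <= j)%N && ~~ `[< symmetric_wrt (Hs j) L >].
    by rewrite mj; apply/asboolPn.
  by rewrite leqNgt jk.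
have [i Hi] := HQ k; rewrite Hi in nS.
have [_ /(_ nS)[v v1]] := fP i; rewrite ltNge => /negP; apply.
apply: le_trans (ef i).
have rv1 : enorm (refl (Q i) v) <= 1 by rewrite enorm_refl.
(* Three errors of e / 3: from [L] to [K k] at [v], across the reflection, and back to [L] at
   [refl (Q i) v]. *)
have := N1P k (leq_trans Nm mk) v v1; rewrite Hi.
have := dP k KkL v v1; have := dP k KkL _ rv1.
have := supp_enbhd (@K0 k) bL KkL v1; have := supp_enbhd (@K0 k) bL KkL rv1.
rewrite !ler_norml => ? ? ? ? /andP[? ?]; apply/andP; split; lra.
Qed.

(** Once all later subspaces preserve [L], a single set close to [L] traps its successors; the
    reverse inclusion follows from [cluster_supp_le] by separation. *)
Lemma iter_sym_cvg_cluster : hausdorff_cvg K L.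
Proof.
move=> e e0; have [N sL] := cluster_eventually_symmetric.
have [d /andP[d0 de] dP] := cluster_supp_le e0.
have [m Nm [KmL _]] := KL N d0.
exists m => k mk; have KkL : K k `<=` enbhd L d.
  by apply: iter_sym_sub_enbhd KmL => // j /andP[mj _]; apply: sL; exact: leq_trans mj.
split; first exact: subset_trans KkL (enbhd_le de).
move=> y Ly; apply: supp_separation (@bK k) _ => //.
- exact: iter_sym_compact.
- exact: iter_sym_convex.
by move=> v v1; apply: le_trans (le_supp v bL Ly) _; exact: dP.
Qed.

End ClusterPoint.
End Sequence.

Theorem convex_iter_sym_cvg (Hs : nat -> {vspace V}) C (s : nat) (Q : 'I_s -> {vspace V}) :
  C !=set0 -> compact C -> convex C -> (forall m, exists i, Hs m = Q i) ->
  exists L, [/\ compact L, convex L, hausdorff_cvg (iter_sym Hs C) L &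
    exists N, forall m, (N <= m)%N -> symmetric_wrt (Hs m) L].
Proof.
move=> C0 kC cC HQ; have [M bC] := compact_ebounded kC.
have [L [kL L0 bL cL KL]] := blaschke_selection
  (iter_sym_neq0 Hs C0) (iter_sym_ebounded (Hs := Hs) bC) (iter_sym_convex (Hs := Hs) cC).
exists L; split=> //; first exact: (iter_sym_cvg_cluster C0 kC cC bC L0 bL kL cL KL HQ).
exact: (cluster_eventually_symmetric C0 bC L0 bL kL cL KL HQ).
Qed.

End IteratedSymmetrization.

(** * From the convex hull back to K *)

Theorem theorem3 (R : realType) (n : nat) (K : set 'rV[R]_n)
  (s : nat) (Q : 'I_s -> {vspace 'rV[R]_n}) (Hs : nat -> {vspace 'rV[R]_n}) :
  K !=set0 -> compact K -> bdry (chull K) `<=` K ->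
  (forall i, (1 <= \dim (Q i))%N /\ (\dim (Q i) <= n - 2)%N) ->
  (forall m, exists i, Hs m = Q i) ->
  exists L : set 'rV[R]_n,
    compact L /\ convex L /\
    hausdorff_cvg (iter_sym Hs K) L /\
    hausdorff_cvg (iter_sym Hs (chull K)) L /\
    (forall j, (forall N, exists m, (N <= m)%N /\ Hs m = Q j) ->
       refl (Q j) @` L = L).
Proof.
move=> [a Ka] kK bdK dQ HQ.
have C0 : chull K !=set0 by exists a; exact: sub_chull.
have [L [kL cL CL [N sL]]] :=
  convex_iter_sym_cvg C0 (chull_compact kK bdK) (@chull_convex _ _ K) HQ.
exists L; split=> //; split=> //; split; last split=> //.
  (* Index 0 is excluded, as [K] itself may differ from its hull; hence the shift to [N'.+1]
     below. *)
  have iterE m : iter_sym Hs K m.+1 = iter_sym Hs (chull K) m.+1.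
    elim: m => [|m /= ->//] /=; have [i ->] := HQ 0%N; have [dQ1 dQ2] := dQ i.
    (* The truncated difference [n - 2] is at least 1, which forces [2 <= n]. *)
    apply: fiber_sym_chull => //; have := leq_trans dQ1 dQ2.
    by rewrite subn_gt0 => /ltnW.
  move=> e e0; have [N' NP] := CL e e0; exists N'.+1 => -[//|m] Nm.
  by rewrite iterE; apply: NP; exact: ltnW.
move=> j /(_ N)[m [Nm <-]]; apply: symmetric_wrt_image; exact: sL.
Qed.
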